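(* For fixed $q\in\mathbb C$ with $|q|>1$, the map $z\mapsto\mathfrak F(z,q)$ is entire. The same holds for the tangent-matched variant $z\mapsto\mathfrak F^{\sharp}(z,q)$.
   Context: For $z\in\mathbb C$ and an integer $i\ge2$, $F(z,i)=i+2\sum_{k=1}^{i-1}(i-k)\cos(2\pi kz/i)$. For $|q|>1$, with $\log$ the principal logarithm and $q^{-z}=e^{-z\log q}$, put $S_q(z)=\sum_{i\ge2}q^{-i}\frac{F(z,i)}{i^2}$, $S_1(z)=\frac{\sin(2\pi z)}{2\pi}$, and $$\mathfrak F(z,q)=(q-1)q\bigl(S_q(z)-q^{-z}\bigr),\qquad \mathfrak F^{\sharp}(z,q)=(q-1)q\Big(S_q(z)-q^{-z}\bigl(1+(\log q)S_1(z)\bigr)\Big).$$ *)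

(* Defs.v *)
From Stdlib Require Import Reals Lra Psatz.
From Coquelicot Require Import Coquelicot.
Open Scope R_scope.
Open Scope C_scope.

Definition Cexp (z : C) : C :=
  ((exp (Re z) * cos (Im z))%R, (exp (Re z) * sin (Im z))%R).

Definition Ccos (z : C) : C := (Cexp (Ci * z) + Cexp (- (Ci * z))) / 2.

Definition Csin (z : C) : C := (Cexp (Ci * z) - Cexp (- (Ci * z))) / (2 * Ci).

(* The value at 0 is irrelevant; see [Carg_bounds] and [Cexp_Clog]. *)
Definition Carg (z : C) : R :=
  if Rle_dec 0 (Im z) then acos (Re z / Cmod z)%R
  else (- acos (Re z / Cmod z))%R.

Definition Clog (z : C) : C := (ln (Cmod z), Carg z).

Lemma Cmod_sqr (z : C) : (Re z * Re z + Im z * Im z = Cmod z * Cmod z)%R.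
Proof.
  unfold Cmod, Re, Im; rewrite sqrt_sqrt; simpl; nra.
Qed.

Lemma Carg_bounds (z : C) : z <> 0 -> (- PI < Carg z <= PI)%R.
Proof.
  intros Hz; pose proof (Cmod_gt_0 z) as [Hp _]; specialize (Hp Hz).
  pose proof (Cmod_sqr z) as Hs; pose proof PI_RGT_0 as Hpi.
  unfold Carg; destruct (Rle_dec 0 (Im z)) as [Hi|Hi].
  - pose proof (acos_bound (Re z / Cmod z)); lra.
  - assert (Hr : (-1 < Re z / Cmod z)%R).
    { apply (Rmult_lt_reg_r (Cmod z)); [exact Hp|].
      unfold Rdiv; rewrite Rmult_assoc, Rinv_l by lra; nra. }
    assert (Hr' : (Re z / Cmod z < 1)%R).
    { apply (Rmult_lt_reg_r (Cmod z)); [exact Hp|].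
      unfold Rdiv; rewrite Rmult_assoc, Rinv_l by lra; nra. }
    pose proof (acos_bound_lt _ (conj Hr Hr')); lra.
Qed.

Lemma Cexp_Clog (z : C) : z <> 0 -> Cexp (Clog z) = z.
Proof.
  intros Hz; pose proof (Cmod_gt_0 z) as [Hp _]; specialize (Hp Hz).
  pose proof (Cmod_sqr z) as Hs.
  assert (Hc : (Re z / Cmod z * Cmod z = Re z)%R) by (field; lra).
  set (c := (Re z / Cmod z)%R) in *.
  assert (Hb : (-1 <= c <= 1)%R) 
    by (split; apply (Rmult_le_reg_r (Cmod z)); try exact Hp; rewrite ?Hc; nra).
  assert (Hq : (Cmod z * sqrt (1 - c²) = Rabs (Im z))%R).
  { rewrite <- (sqrt_Rsqr (Cmod z)) at 1 by lra.
    rewrite <- sqrt_mult, <- sqrt_Rsqr_abs by (unfold Rsqr; nra).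
    f_equal; unfold Rsqr; rewrite <- Hc in Hs; nra. }
  assert (Hz' : z = (Re z, Im z)) by apply surjective_pairing.
  rewrite Hz' at 2; unfold Cexp, Clog; simpl.
  rewrite exp_ln by exact Hp.
  unfold Carg; fold c; destruct (Rle_dec 0 (Im z)) as [Hi|Hi].
  - rewrite cos_acos, sin_acos, Hq, Rabs_pos_eq by lra; f_equal; lra.
  - rewrite cos_neg, sin_neg, cos_acos, sin_acos by lra.
    rewrite Ropp_mult_distr_r_reverse, Hq, Rabs_left by lra; f_equal; lra.
Qed.

(* The sum of a complex series taken componentwise; it is the limit of the
   partial sums whenever the series converges, and is unspecified otherwise. *)
Definition CSeries (a : nat -> C) : C :=
  (Series (fun n => Re (a n)), Series (fun n => Im (a n))).

Definition FF (z : C) (i : nat) : C :=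
  INR i + 2 * sum_n_m (fun k => INR (i - k) * Ccos (2 * PI * INR k * z / INR i))
                      1 (i - 1).

Definition Sq_term (q z : C) (i : nat) : C := / q ^ i * (FF z i / INR i ^ 2).

(* The summation index is [i = n + 2]. *)
Definition Sq (q z : C) : C := CSeries (fun n => Sq_term q z (n + 2)).

Definition S1 (z : C) : C := Csin (2 * PI * z) / (2 * PI).

Definition Cqpow_opp (q z : C) : C := Cexp (- (z * Clog q)).

Definition frakF (z q : C) : C := (q - 1) * q * (Sq q z - Cqpow_opp q z).

Definition frakF_sharp (z q : C) : C :=
  (q - 1) * q * (Sq q z - Cqpow_opp q z * (1 + Clog q * S1 z)).

(* Differentiability over the field C, i.e. complex differentiability. *)
Definition entire (f : C -> C) : Prop :=
  forall z : C, @ex_derive C_AbsRing C_NormedModule f z.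

(* Main.v *)
Require Import Defs.
From Stdlib Require Import Reals Lra Lia Psatz.
From Coquelicot Require Import Coquelicot.

(** Each [FF z i] is a finite combination of exponentials [Cexp (c * z)] whose
    frequencies satisfy [Cmod c <= 2 * PI] whatever [i] is.  Hence, on a disc
    around a given point, [FF z i] is [O(i ^ 2)] with a constant independent of
    [i], and the division by [i ^ 2] leaves a series dominated by a geometric
    series of ratio [/ Cmod q < 1].

    Termwise differentiation then needs no Cauchy theory.  The predicate
    [second_order f z M] says that a single constant [M] bounds the value of [f]
    at [z], its derivative there, and the quotient of its first-order Taylor
    remainder by the square of the increment.  Exponentials have this property
    because [Cexp w - 1 - w = O(w ^ 2)] ([Cexp_remainder], [second_order_Cexp]).
    It is stable under linear combinations, and under series whose constants are
    summable ([second_order_CSeries]), and it implies complex differentiability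
    ([second_order_derive]).  The terms subtracted from [Sq q z] are
    combinations of exponentials too: the sine in [S1] only shifts the frequency
    of [Cqpow_opp q z] ([Cqpow_opp_S1]). *)

Local Open Scope C_scope.

(** * The complex exponential *)

Lemma Cexp_plus (u v : C) : Cexp (u + v) = Cexp u * Cexp v.
Proof.
  destruct u as [a b], v as [c d]; unfold Cexp, Cmult; simpl.
  rewrite exp_plus, cos_plus, sin_plus; f_equal; ring.
Qed.

Lemma Cmod_Cexp (w : C) : Cmod (Cexp w) = exp (Re w).
Proof.
  unfold Cmod, Cexp; simpl fst; simpl snd.
  replace (_ + _)%R with ((exp (Re w))²).
  - apply sqrt_Rsqr, Rlt_le, exp_pos.
  - rewrite <- (Rmult_1_r (exp (Re w))²), <- (sin2_cos2 (Im w)).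
    unfold Rsqr; ring.
Qed.

Lemma exp_le_mono (x y : R) : (x <= y)%R -> (exp x <= exp y)%R.
Proof. intros [H| ->]; [left; now apply exp_increasing | apply Rle_refl]. Qed.

Lemma Cmod_Cexp_le (w : C) : (Cmod (Cexp w) <= exp (Cmod w))%R.
Proof.
  rewrite Cmod_Cexp; apply exp_le_mono.
  eapply Rle_trans; [apply Rle_abs | apply re_le_Cmod].
Qed.

(** The functions [t => Re (p * Cexp (t * w))] form a family closed under
    differentiation, so that the real mean value theorem can be used repeatedly
    along the segment from [0] to [w]. *)
Lemma derivable_pt_lim_Re_Cexp (p w : C) (t : R) :
  derivable_pt_lim (fun t : R => Re (p * Cexp (t * w))) t (Re (p * w * Cexp (t * w))).
Proof.
  apply is_derive_Reals; destruct p as [a b], w as [x y].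
  unfold Cexp, Cmult, Re, Im; simpl.
  unfold Rminus; auto_derive; [exact I | ring].
Qed.

(** The mean value theorem fails for complex-valued functions, so it is used on
    the real function [t => Re (p * Cexp (t * w))], with [p] the conjugate of the
    remainder [r]: then [Re (p * r)] is [Cmod r ^ 2], and one factor [Cmod r]
    cancels at the end.  Two mean values give the factor [Cmod w ^ 2]. *)
Lemma Cexp_remainder (w : C) :
  (Cmod (Cexp w - 1 - w)%C <= Cmod w ^ 2 * exp (Cmod w))%R.
Proof.
  set (r := Cexp w - 1 - w); set (p := Cconj r).
  destruct (MVT_cor2 _ _ 0 1 Rlt_0_1 (fun t _ => derivable_pt_lim_Re_Cexp p w t))
    as [c [Hc [Hc0 Hc1]]].
  destruct (MVT_cor2 _ _ 0 c Hc0 (fun t _ => derivable_pt_lim_Re_Cexp (p * w) w t))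
    as [s [Hs [Hs0 Hs1]]].
  assert (H0 : Cexp (0 * w) = 1).
  { replace (0 * w) with (RtoC 0) by ring.
    unfold Cexp, RtoC; simpl; rewrite exp_0, cos_0, sin_0; f_equal; ring. }
  assert (Heq : (Cmod r ^ 2 = c * Re (p * w * w * Cexp (s * w))%C)%R).
  { rewrite H0, Cmult_1_l in Hc; rewrite H0 in Hs.
    transitivity (Re (p * r)).
    - rewrite Cmult_comm; unfold p.
      rewrite <- Cmod2_conj; reflexivity.
    - transitivity (Re (p * Cexp w) - Re (p * 1) - Re (p * w * 1))%R; [|lra].
      unfold r, Cminus, Cmult, Copp, Cplus, Re, RtoC; simpl; ring. }
  assert (Hb : (Re (p * w * w * Cexp (s * w))%C <= Cmod r * (Cmod w ^ 2 * exp (Cmod w)))%R).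
  { eapply Rle_trans; [apply Rle_abs|].
    eapply Rle_trans; [apply re_le_Cmod|].
    rewrite !Cmod_mult; unfold p; rewrite Cmod_conj.
    assert (H : (Cmod (Cexp (s * w)%C) <= exp (Cmod w))%R).
    { eapply Rle_trans; [apply Cmod_Cexp_le | apply exp_le_mono].
      rewrite Cmod_mult, Cmod_R, Rabs_pos_eq by lra.
      pose proof (Cmod_ge_0 w); nra. }
    pose proof (Cmod_ge_0 r); pose proof (Cmod_ge_0 w).
    simpl; rewrite Rmult_1_r, !Rmult_assoc.
    repeat (apply Rmult_le_compat_l; [assumption|]); exact H. }
  pose proof (Cmod_ge_0 r) as Hr; pose proof (exp_pos (Cmod w)).
  pose proof (pow2_ge_0 (Cmod w)).
  set (B := (Cmod w ^ 2 * exp (Cmod w))%R) in *.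
  assert (0 <= B)%R by (apply Rmult_le_pos; lra).
  destruct (Rle_lt_or_eq_dec _ _ Hr) as [Hr'|Hr']; [|rewrite <- Hr'; assumption].
  apply (Rmult_le_reg_l (Cmod r)); [exact Hr'|].
  assert (0 <= Cmod r * B)%R by (apply Rmult_le_pos; lra).
  replace (Cmod r * Cmod r)%R with (Cmod r ^ 2)%R by ring; nra.
Qed.

(** * Functions with a quadratic Taylor remainder *)

(** One constant [M] serves the three estimates so that, for a family of
    functions, the summability of one sequence gives the convergence of the
    series, of the series of derivatives and of the series of remainders. *)
Definition second_order (f : C -> C) (z : C) (M : R) : Prop :=
  (Cmod (f z) <= M)%R /\
  exists d : C, (Cmod d <= M)%R /\
    forall h : C, (Cmod h <= 1)%R ->
      (Cmod (f (z + h) - f z - h * d)%C <= M * Cmod h ^ 2)%R.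

Lemma second_order_ge_0 f z M : second_order f z M -> (0 <= M)%R.
Proof. intros [H _]; eapply Rle_trans; [apply Cmod_ge_0 | exact H]. Qed.

Lemma second_order_ext f g z M :
  (forall w, f w = g w) -> second_order f z M -> second_order g z M.
Proof.
  intros E [H [d [Hd Hr]]]; split; [now rewrite <- E|].
  exists d; split; [exact Hd|]; intros h Hh; rewrite <- !E; auto.
Qed.

Lemma second_order_weaken f z M M' :
  (M <= M')%R -> second_order f z M -> second_order f z M'.
Proof.
  intros HM [H [d [Hd Hr]]]; split; [lra|].
  exists d; split; [lra|]; intros h Hh.
  eapply Rle_trans; [now apply Hr|].
  apply Rmult_le_compat_r; [apply pow2_ge_0 | exact HM].
Qed.

Lemma second_order_const c z : second_order (fun _ => c) z (Cmod c).
Proof.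
  split; [apply Rle_refl|]; exists 0; split.
  - rewrite Cmod_0; apply Cmod_ge_0.
  - intros h _; replace (c - c - h * 0) with (RtoC 0) by ring.
    rewrite Cmod_0; apply Rmult_le_pos; [apply Cmod_ge_0 | apply pow2_ge_0].
Qed.

Lemma second_order_plus f g z M N :
  second_order f z M -> second_order g z N ->
  second_order (fun w => f w + g w) z (M + N).
Proof.
  intros [H [d [Hd Hr]]] [H' [d' [Hd' Hr']]]; split.
  - eapply Rle_trans; [apply Cmod_triangle | lra].
  - exists (d + d'); split; [eapply Rle_trans; [apply Cmod_triangle | lra]|].
    intros h Hh; specialize (Hr h Hh); specialize (Hr' h Hh).
    replace (_ - _ - _)
      with ((f (z + h) - f z - h * d) + (g (z + h) - g z - h * d')) by ring.
    eapply Rle_trans; [apply Cmod_triangle | lra].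
Qed.

Lemma second_order_scal c f z M :
  second_order f z M -> second_order (fun w => c * f w) z (Cmod c * M).
Proof.
  pose proof (Cmod_ge_0 c) as Hc; intros [H [d [Hd Hr]]]; split.
  - rewrite Cmod_mult; now apply Rmult_le_compat_l.
  - exists (c * d); split; [rewrite Cmod_mult; now apply Rmult_le_compat_l|].
    intros h Hh; replace (_ - _ - _) with (c * (f (z + h) - f z - h * d)) by ring.
    rewrite Cmod_mult, Rmult_assoc; apply Rmult_le_compat_l; auto.
Qed.

Lemma second_order_minus f g z M N :
  second_order f z M -> second_order g z N ->
  second_order (fun w => f w - g w) z (M + N).
Proof.
  intros Hf Hg; apply second_order_ext with (fun w => f w + - (1) * g w).
  - intros w; ring.
  - apply second_order_plus; [exact Hf|].
    apply (second_order_scal (- (1))) in Hg; now rewrite Cmod_m1, Rmult_1_l in Hg.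
Qed.

Lemma second_order_sum_n_m (f : nat -> C -> C) z M m :
  (0 <= M)%R ->
  (forall k, (1 <= k <= m)%nat -> second_order (f k) z M) ->
  second_order (fun w => sum_n_m (fun k => f k w) 1 m) z (INR m * M).
Proof.
  intros HM; induction m as [|m IH]; intros Hf.
  - apply second_order_ext with (fun _ => 0).
    + intros w; rewrite sum_n_m_zero by lia; reflexivity.
    + simpl; rewrite Rmult_0_l; pose proof (second_order_const 0 z) as H.
      now rewrite Cmod_0 in H.
  - apply second_order_ext with (fun w => sum_n_m (fun k => f k w) 1 m + f (S m) w).
    + intros w; rewrite sum_n_Sm by lia; reflexivity.
    + rewrite S_INR, Rmult_plus_distr_r, Rmult_1_l; apply second_order_plus.
      * apply IH; intros k Hk; apply Hf; lia.
      * apply Hf; lia.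
Qed.

(** The constant depends on the frequency [c] only through the bound [B]; this
    gives a uniform constant for the cosines in [FF z i].  The radius of [z] is
    enlarged by [1] to absorb the exponential of the increment, and [1 <= B] lets
    [B ^ 2] dominate the constants of the value and of the derivative. *)
Lemma second_order_Cexp (c z : C) (B : R) :
  (1 <= B)%R -> (Cmod c <= B)%R ->
  second_order (fun w => Cexp (c * w)) z (B ^ 2 * exp (B * (Cmod z + 1))).
Proof.
  intros HB Hc.
  assert (HE : (Cmod (Cexp (c * z)%C) <= exp (B * Cmod z))%R).
  { eapply Rle_trans; [apply Cmod_Cexp_le | apply exp_le_mono].
    rewrite Cmod_mult; apply Rmult_le_compat_r; [apply Cmod_ge_0 | exact Hc]. }
  assert (HB2 : (1 <= B ^ 2 /\ B <= B ^ 2)%R) by nra.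
  assert (Hexp : (exp (B * (Cmod z + 1)) = exp (B * Cmod z) * exp B)%R)
    by (rewrite <- exp_plus; f_equal; ring).
  pose proof (exp_pos (B * Cmod z)) as Hz.
  assert (Hle : (exp (B * Cmod z) <= exp (B * (Cmod z + 1)))%R)
    by (apply exp_le_mono; nra).
  pose proof (Cmod_ge_0 c) as Hc0; pose proof (Cmod_ge_0 (Cexp (c * z))) as He0.
  split; [nra|]; exists (c * Cexp (c * z)); split.
  - rewrite Cmod_mult; apply Rle_trans with (B * exp (B * Cmod z))%R; [|nra].
    apply Rmult_le_compat; assumption.
  - intros h Hh; pose proof (Cmod_ge_0 h) as Hh0.
    replace (c * (z + h)) with (c * z + c * h) by ring; rewrite Cexp_plus.
    replace (_ - _ - _) with (Cexp (c * z) * (Cexp (c * h) - 1 - c * h)) by ring.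
    rewrite Cmod_mult, Hexp.
    apply Rle_trans with (exp (B * Cmod z) * ((B * Cmod h) ^ 2 * exp B))%R;
      [|right; ring].
    apply Rmult_le_compat; try apply Cmod_ge_0; [exact HE|].
    eapply Rle_trans; [apply Cexp_remainder|]; rewrite Cmod_mult.
    assert (Hch : (0 <= Cmod c * Cmod h <= B * Cmod h)%R) by nra.
    apply Rmult_le_compat; [apply pow2_ge_0 | left; apply exp_pos | |].
    + apply pow_incr; exact Hch.
    + apply exp_le_mono; nra.
Qed.

(** Besides differentiability, this records the estimates for the derivative
    itself, so that they can be transferred to [C_derive f z] by uniqueness. *)
Lemma second_order_derive f z M :
  second_order f z M ->
  exists d, @is_derive C_AbsRing C_NormedModule f z d /\ (Cmod d <= M)%R /\
    forall h : C, (Cmod h <= 1)%R ->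
      (Cmod (f (z + h) - f z - h * d)%C <= M * Cmod h ^ 2)%R.
Proof.
  intros Hf; pose proof (second_order_ge_0 _ _ _ Hf) as HM.
  destruct Hf as [_ [d [Hd Hr]]]; exists d; split; [|now split].
  split; [apply is_linear_scal_l|].
  intros x Hx.
  apply (is_filter_lim_locally_unique (V := AbsRing_NormedModule C_AbsRing)) in Hx; subst x.
  intros eps; pose proof (cond_pos eps) as Heps.
  assert (Hdel : (0 < Rmin 1 (eps / (M + 1)))%R)
    by (apply Rmin_pos; [lra | apply Rdiv_lt_0_compat; lra]).
  (* On the disc of radius [Rmin 1 (eps / (M + 1))] the remainder estimate holds
     and [M * Cmod (y - z)] is at most [eps]; adding [1] covers [M = 0]. *)
  exists (mkposreal _ Hdel); intros y Hy; change C in y.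
  change (Cmod (y - z)%C < Rmin 1 (eps / (M + 1)))%R in Hy.
  change (Cmod (f y - f z - (y - z) * d)%C <= eps * Cmod (y - z)%C)%R.
  pose proof (Rmin_l 1 (eps / (M + 1))); pose proof (Rmin_r 1 (eps / (M + 1))).
  specialize (Hr (y - z) ltac:(lra)).
  replace (z + (y - z)) with y in Hr by ring.
  eapply Rle_trans; [exact Hr|].
  pose proof (Cmod_ge_0 (y - z)).
  assert (Cmod (y - z)%C * (M + 1) <= eps)%R.
  { replace (pos eps) with (eps / (M + 1) * (M + 1))%R by (field; lra).
    apply Rmult_le_compat_r; lra. }
  nra.
Qed.

(** * Series of complex functions *)

(** Both component series are dominated by [b], since the modulus bounds the real
    and the imaginary parts; their limits are combined in the product topology,
    which is that of the normed module [C]. *)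
Lemma is_series_CSeries (a : nat -> C) (b : nat -> R) :
  (forall n, (Cmod (a n) <= b n)%R) -> ex_series b ->
  @is_series C_AbsRing C_NormedModule a (CSeries a).
Proof.
  intros Hab Hb.
  assert (Hsum : forall n, sum_n a n = (sum_n (fun k => Re (a k)) n, sum_n (fun k => Im (a k)) n)).
  { induction n as [|n IH].
    - rewrite !sum_O; apply surjective_pairing.
    - rewrite !sum_Sn, IH; reflexivity. }
  assert (Hre : is_series (fun n => Re (a n)) (Series (fun n => Re (a n)))).
  { apply Series_correct, (@ex_series_le R_AbsRing R_CompleteNormedModule _ b); [|exact Hb].
    intros n; eapply Rle_trans; [|apply Hab]; apply re_le_Cmod. }
  assert (Him : is_series (fun n => Im (a n)) (Series (fun n => Im (a n)))).
  { apply Series_correct, (@ex_series_le R_AbsRing R_CompleteNormedModule _ b); [|exact Hb].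
    intros n; eapply Rle_trans; [|apply Hab].
    eapply Rle_trans; [apply Rmax_r | apply Rmax_Cmod]. }
  apply (filterlim_ext (fun n => (sum_n (fun k => Re (a k)) n, sum_n (fun k => Im (a k)) n))).
  { intros n; symmetry; apply Hsum. }
  intros P [eps HP].
  destruct (Hre _ (locally_ball _ eps)) as [N1 H1].
  destruct (Him _ (locally_ball _ eps)) as [N2 H2].
  exists (max N1 N2); intros n Hn; apply HP; split; [apply H1 | apply H2]; lia.
Qed.

Lemma Cmod_CSeries_le (a : nat -> C) (l : C) (b : nat -> R) :
  @is_series C_AbsRing C_NormedModule a l ->
  (forall n, (Cmod (a n) <= b n)%R) -> ex_series b -> (Cmod l <= Series b)%R.
Proof.
  intros Ha Hab Hb.
  apply (is_lim_seq_le (fun n => Cmod (sum_n a n)) (sum_n b) (Cmod l) (Series b)).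
  - intros n; eapply Rle_trans; [apply (@norm_sum_n_m C_AbsRing C_NormedModule)|].
    apply sum_n_m_le, Hab.
  - exact (filterlim_comp _ _ _ _ _ _ _ _ Ha (@filterlim_norm C_AbsRing C_NormedModule l)).
  - apply Series_correct; exact Hb.
Qed.

(** The estimates at [z] alone control [f] on the unit disc around [z]: value,
    linear term and remainder contribute [M] each.  This makes the series of the
    values at [z + h] converge. *)
Lemma second_order_near f z M h :
  second_order f z M -> (Cmod h <= 1)%R -> (Cmod (f (z + h)%C) <= 3 * M)%R.
Proof.
  intros Hf Hh; pose proof (second_order_ge_0 _ _ _ Hf) as HM.
  destruct Hf as [Hz [d [Hd Hr]]]; specialize (Hr h Hh).
  replace (f (z + h)) with ((f (z + h) - f z - h * d) + (f z + h * d)) by ring.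
  pose proof (Cmod_ge_0 h); pose proof (Cmod_ge_0 d).
  eapply Rle_trans; [apply Cmod_triangle|].
  eapply Rle_trans; [apply Rplus_le_compat_l, Cmod_triangle|].
  rewrite Cmod_mult.
  assert (Cmod h * Cmod d <= M)%R by nra.
  assert (Cmod h ^ 2 <= 1)%R by nra.
  assert (M * Cmod h ^ 2 <= M)%R by nra.
  lra.
Qed.

(** Termwise differentiation: the remainder of the sum is the sum of the
    remainders, by linearity of the limit. *)
Lemma second_order_CSeries (f : nat -> C -> C) (z : C) (M : nat -> R) :
  (forall n, second_order (f n) z (M n)) -> ex_series M ->
  second_order (fun w => CSeries (fun n => f n w)) z (Series M).
Proof.
  intros Hf HM.
  (* [C_derive] makes the choice of a derivative for every [n]. *)
  assert (Hd : forall n, (Cmod (C_derive (f n) z) <= M n)%R /\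
    forall h : C, (Cmod h <= 1)%R ->
      (Cmod (f n (z + h) - f n z - h * C_derive (f n) z)%C <= M n * Cmod h ^ 2)%R).
  { intros n; destruct (second_order_derive _ _ _ (Hf n)) as [d [E Hd]].
    rewrite (is_C_derive_unique _ _ _ E); exact Hd. }
  assert (Sz : @is_series C_AbsRing C_NormedModule (fun n => f n z) (CSeries (fun n => f n z)))
    by (apply (is_series_CSeries _ M); [intros n; apply Hf | exact HM]).
  pose proof (is_series_CSeries _ M (fun n => proj1 (Hd n)) HM) as Sd.
  split; [apply (Cmod_CSeries_le _ _ _ Sz); [intros n; apply Hf | exact HM]|].
  eexists; split; [apply (Cmod_CSeries_le _ _ _ Sd (fun n => proj1 (Hd n)) HM)|].
  intros h Hh.
  assert (Sh : @is_series C_AbsRing C_NormedModule (fun n => f n (z + h))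
                 (CSeries (fun n => f n (z + h)))).
  { apply (is_series_CSeries _ (fun n => 3 * M n)%R).
    - intros n; now apply second_order_near.
    - now apply (@ex_series_scal R_AbsRing R_NormedModule). }
  pose proof (is_series_minus _ _ _ _ (is_series_minus _ _ _ _ Sh Sz)
                (is_series_scal h _ _ Sd)) as Sr.
  rewrite Rmult_comm, <- Series_scal_l.
  apply (Cmod_CSeries_le _ _ _ Sr).
  - intros n; rewrite Rmult_comm; now apply Hd.
  - now apply (@ex_series_scal R_AbsRing R_NormedModule).
Qed.

(** * The series defining [Sq] and the two entire functions *)

(** The constant of [second_order_Cexp] for frequencies of modulus at most [2 * PI]. *)
Definition cos_bound (z : C) : R := ((2 * PI) ^ 2 * exp (2 * PI * (Cmod z + 1)))%R.

Lemma second_order_Ccos (x : R) (z : C) :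
  (0 <= x <= 1)%R -> second_order (fun w => Ccos (2 * PI * x * w)) z (cos_bound z).
Proof.
  intros Hx; pose proof PI2_1 as HPI.
  assert (HB : (1 <= 2 * PI)%R) by lra.
  assert (Hp : (Cmod (Ci * (2 * PI * x))%C <= 2 * PI)%R).
  { rewrite !Cmod_mult, Cmod_Ci, !Cmod_R.
    rewrite (Rabs_pos_eq 2), (Rabs_pos_eq PI), (Rabs_pos_eq x) by lra; nra. }
  assert (Hm : (Cmod (- (Ci * (2 * PI * x)))%C <= 2 * PI)%R) by now rewrite Cmod_opp.
  pose proof (second_order_plus _ _ _ _ _
    (second_order_Cexp _ z _ HB Hp) (second_order_Cexp _ z _ HB Hm)) as H.
  apply (second_order_scal (/ 2)) in H.
  replace (cos_bound z) with (Cmod (/ 2)%C * (cos_bound z + cos_bound z))%R.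
  - eapply second_order_ext; [|exact H].
    intros w; cbv beta; unfold Ccos, Cdiv; rewrite Cmult_comm.
    do 2 f_equal; f_equal; ring.
  - rewrite <- RtoC_inv, Cmod_R, Rabs_pos_eq by lra; field.
Qed.

(** At most [i] cosines, each with weight at most [i] and frequency parameter
    [k / i] in the unit interval, whence the quadratic growth in [i]. *)
Lemma second_order_FF (i : nat) (z : C) :
  (1 <= i)%nat ->
  second_order (fun w => FF w i) z (INR i ^ 2 * (1 + 2 * cos_bound z)).
Proof.
  intros Hi; apply le_INR in Hi as HiR; simpl in HiR.
  pose proof (second_order_ge_0 _ _ _ (second_order_Ccos 0 z ltac:(lra))) as HK.
  set (K := cos_bound z) in *.
  assert (Hsum : second_order
    (fun w => sum_n_m (fun k => INR (i - k) * Ccos (2 * PI * INR k * w / INR i)) 1 (i - 1))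
    z (INR (i - 1) * (INR i * K))).
  { apply second_order_sum_n_m; [apply Rmult_le_pos; lra|].
    intros k Hk; apply second_order_weaken with (Cmod (INR (i - k)) * K)%R.
    - apply Rmult_le_compat_r; [exact HK|].
      rewrite Cmod_R, Rabs_pos_eq by apply pos_INR; apply le_INR; lia.
    - apply second_order_scal.
      apply second_order_ext with (fun w => Ccos (2 * PI * (INR k / INR i)%R * w)).
      + intros w; cbv beta; rewrite RtoC_div by lra; f_equal; unfold Cdiv; ring.
      + apply second_order_Ccos; split.
        * apply Rdiv_le_0_compat; [apply pos_INR | lra].
        * apply Rle_div_l; [lra|]; rewrite Rmult_1_l; apply le_INR; lia. }
  apply (second_order_scal 2) in Hsum.
  pose proof (second_order_plus _ _ _ _ _ (second_order_const (INR i) z) Hsum) as H.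
  eapply second_order_weaken; [|exact H].
  rewrite !Cmod_R, !Rabs_pos_eq by lra.
  assert (Hl : (INR (i - 1) <= INR i)%R) by (apply le_INR; lia).
  assert (0 <= INR i * K)%R by (apply Rmult_le_pos; lra).
  assert (INR (i - 1) * (INR i * K) <= INR i * (INR i * K))%R
    by (apply Rmult_le_compat_r; assumption).
  nra.
Qed.

Lemma second_order_Sq_term (q z : C) (i : nat) :
  (1 < Cmod q)%R -> (1 <= i)%nat ->
  second_order (fun w => Sq_term q w i) z ((/ Cmod q) ^ i * (1 + 2 * cos_bound z)).
Proof.
  intros Hq Hi; apply le_INR in Hi as HiR; simpl in HiR.
  assert (Hq0 : q <> 0) by (apply Cmod_gt_0; lra).
  assert (Hi0 : RtoC (INR i) <> 0) by (apply Cmod_gt_0; rewrite Cmod_R, Rabs_pos_eq; lra).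
  pose proof (second_order_scal (/ q ^ i * / INR i ^ 2) _ _ _ (second_order_FF i z Hi)) as H.
  replace ((/ Cmod q) ^ i * _)%R with
    (Cmod (/ q ^ i * / INR i ^ 2)%C * (INR i ^ 2 * (1 + 2 * cos_bound z)))%R.
  - eapply second_order_ext; [|exact H].
    intros w; unfold Sq_term, Cdiv; ring.
  - rewrite Cmod_mult, !Cmod_inv, !Cmod_pow, Cmod_R, Rabs_pos_eq, pow_inv
      by (try apply Cpow_nz; trivial; lra).
    field; split; [apply pow_nonzero; lra | lra].
Qed.

Lemma ex_series_Sq_bound (q : C) (K : R) :
  (1 < Cmod q)%R -> ex_series (fun n => (/ Cmod q) ^ (n + 2) * K)%R.
Proof.
  intros Hq; apply ex_series_scal_r, (ex_series_ext (fun n => (/ Cmod q) ^ (2 + n))%R).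
  - intros n; f_equal; lia.
  - apply -> (ex_series_incr_n (fun n => (/ Cmod q) ^ n)%R 2); apply ex_series_geom.
    assert (0 < / Cmod q)%R by (apply Rinv_0_lt_compat; lra).
    rewrite Rabs_pos_eq by lra; rewrite <- Rinv_1; apply Rinv_lt_contravar; lra.
Qed.

Lemma second_order_Sq (q z : C) :
  (1 < Cmod q)%R -> exists M, second_order (Sq q) z M.
Proof.
  intros Hq; eexists; apply second_order_CSeries.
  - intros n; apply second_order_Sq_term; [exact Hq | lia].
  - apply ex_series_Sq_bound; exact Hq.
Qed.

Lemma second_order_Cexp_linear (c z : C) : exists M, second_order (fun w => Cexp (c * w)) z M.
Proof.
  eexists; apply (second_order_Cexp c z (Rmax 1 (Cmod c))); [apply Rmax_l | apply Rmax_r].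
Qed.

(** Expanding the sine turns the product into a linear combination of
    exponentials, to which the closure properties apply directly. *)
Lemma Cqpow_opp_S1 (q z : C) :
  Cqpow_opp q z * (1 + Clog q * S1 z) =
  Cexp (- Clog q * z) + Clog q / (2 * PI) / (2 * Ci) *
    (Cexp ((2 * PI * Ci - Clog q) * z) - Cexp ((- (2 * PI * Ci) - Clog q) * z)).
Proof.
  replace ((2 * PI * Ci - Clog q) * z) with (- (z * Clog q) + Ci * (2 * PI * z)) by ring.
  replace ((- (2 * PI * Ci) - Clog q) * z) with (- (z * Clog q) + - (Ci * (2 * PI * z))) by ring.
  replace (- Clog q * z) with (- (z * Clog q)) by ring.
  rewrite !Cexp_plus; unfold Cqpow_opp, S1, Csin, Cdiv; ring.
Qed.

Lemma entire_of_second_order (f : C -> C) :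
  (forall z, exists M, second_order f z M) -> entire f.
Proof.
  intros H z; destruct (H z) as [M HM].
  destruct (second_order_derive _ _ _ HM) as [d [Hd _]]; now exists d.
Qed.

Theorem propositionB1 (q : C) (hq : (1 < Cmod q)%R) :
  (forall z : C,
     @is_series C_AbsRing C_NormedModule (fun n : nat => Sq_term q z (n + 2)) (Sq q z)) /\
  entire (fun z : C => frakF z q) /\
  entire (fun z : C => frakF_sharp z q).
Proof.
  split; [|split].
  - intros z; eapply is_series_CSeries; [|apply (ex_series_Sq_bound q (1 + 2 * cos_bound z) hq)].
    intros n; apply second_order_Sq_term; [exact hq | lia].
  - apply entire_of_second_order; intros z.
    destruct (second_order_Sq q z hq) as [M HM].
    destruct (second_order_Cexp_linear (- Clog q) z) as [N HN].
    eexists; apply second_order_scal, second_order_minus; [exact HM|].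
    eapply second_order_ext; [|exact HN].
    intros w; unfold Cqpow_opp; f_equal; ring.
  - apply entire_of_second_order; intros z.
    destruct (second_order_Sq q z hq) as [M HM].
    destruct (second_order_Cexp_linear (- Clog q) z) as [N HN].
    destruct (second_order_Cexp_linear (2 * PI * Ci - Clog q) z) as [N1 HN1].
    destruct (second_order_Cexp_linear (- (2 * PI * Ci) - Clog q) z) as [N2 HN2].
    eexists; apply second_order_scal, second_order_minus; [exact HM|].
    eapply second_order_ext; [intros w; symmetry; apply Cqpow_opp_S1|].
    apply second_order_plus; [exact HN|].
    apply second_order_scal, second_order_minus; [exact HN1 | exact HN2].
Qed.
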